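(* For every $\mathsf{sSKSg}$ proof of size $n$ there exists a proof of the same formula in $\mathsf{sFrege}$ whose length and size are respectively $O(n^4)$ and $O(n^5)$.
   Context: CoS: formulae built from units $\mathsf f,\mathsf t$, atoms $a,\bar a,\dots$, formula variables $A,\bar A,\dots$ by $[\alpha\vee\beta]$ and $(\alpha\wedge\beta)$; $\bar\cdot$ involution on atoms and on variables with $\bar a\ne a$, $\bar A\ne A$; the De Morgan dual $\bar\alpha$ exchanges $\vee/\wedge$, $\mathsf t/\mathsf f$ and negates atoms and variables. Equality $=$ is the smallest context-closed equivalence containing commutativity and associativity of $\vee,\wedge$, $[\alpha\vee\mathsf f]=\alpha$, $(\alpha\wedge\mathsf t)=\alpha$, $[\mathsf t\vee\mathsf t]=\mathsf t$, $(\mathsf f\wedge\mathsf f)=\mathsf f$. A substitution $\sigma$ maps variables to formulae (applied simultaneously, $\bar A\mapsto$ dual of $\sigma(A)$); a renaming maps atoms to atoms. A rule $\alpha/\beta$ has instances $\alpha\rho\sigma/\beta\rho\sigma$ and generates steps $\xi\{\gamma\}/\xi\{\delta\}$ for any context (formula with one hole) $\xi$. A derivation in $\mathcal S$ is a chain of formulae alternating $=$-steps and steps generated by rules of $\mathcal S$; its size is the number of occurrences of units, atoms and variables; a proof has premiss $\mathsf t$. $\mathsf{SKSg}$ has the rules $\mathsf t/[A\vee\bar A]$, $(A\wedge\bar A)/\mathsf f$, $\mathsf f/A$, $A/\mathsf t$, $[A\vee A]/A$, $A/(A\wedge A)$, $(A\wedge[B\vee C])/[(A\wedge B)\vee C]$.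 $\mathsf{sSKSg}$: a proof of $\mathsf{SKSg}$ in which, in addition, one may use steps of the substitution rule from a whole formula $\gamma$ (not inside a context) to $\gamma\sigma$. $\mathsf{Frege}$: formulae over $\mathsf t,\mathsf f$, non-negated variables, $\vee,\wedge,\to,\neg$; axiom schemes $F_1: A\to(B\to(A\wedge B))$; $F_2:(A\wedge B)\to A$; $F_3:(A\wedge B)\to B$; $F_4:A\to(A\vee B)$; $F_5:B\to(A\vee B)$; $F_6:\neg\neg A\to A$; $F_7:A\to\neg\neg A$; $F_8:A\to(B\to A)$; $F_9:\neg A\to(A\to B)$; $F_{10}:(A\to(B\to C))\to((A\to B)\to(A\to C))$; $F_{11}:(A\to C)\to((B\to C)\to((A\vee B)\to C))$; $F_{12}:(A\to(B\to C))\to(B\to(A\to C))$; $F_{13}:(A\to B)\to(\neg B\to\neg A)$; $F_{14}:\mathsf f\to(A\wedge\neg A)$; $F_{15}:(A\wedge\neg A)\to\mathsf f$; $F_{16}:\mathsf t\to(A\vee\neg A)$; $F_{17}:(A\vee\neg A)\to\mathsf t$ (instances by substituting formulae), and modus ponens. $\mathsf{sFrege}$: a proof is a sequence of formulae each of which is an axiom instance, follows by modus ponens from earlier formulae, or is $\alpha_j\sigma$ for an earlier formula $\alpha_j$ and a substitution $\sigma$; the last formula is its conclusion; length = number of formulae, size = number of occurrences of units and variables. Translation between languages: atoms and variables correspond to Frege variables, negated atoms/variables to $\neg$ of variables, $\neg\alpha$ to the dual, $\alpha\to\beta$ to $[\bar\alpha\vee\beta]$. *)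

(* Defs.v *)
From mathcomp Require Import all_boot.

Set Implicit Arguments.
Unset Strict Implicit.
Unset Printing Implicit Defensive.

(* Calculus of structures *)

(* Atoms, and likewise formula variables, come in dual pairs: (true, i) is the
   positive member of the i-th pair and (false, i) the negated one. *)
Definition literal := (bool * nat)%type.
Definition lneg (l : literal) : literal := (~~ l.1, l.2).

Inductive cform :=
| CTrue
| CFalse
| CAtom (a : literal)
| CVar (A : literal)
| COr (alpha beta : cform)
| CAnd (alpha beta : cform).

Declare Scope cos_scope.
Delimit Scope cos_scope with C.
Bind Scope cos_scope with cform.
Notation "alpha \/ beta" := (COr alpha beta) : cos_scope.
Notation "alpha /\ beta" := (CAnd alpha beta) : cos_scope.

Fixpoint dual (alpha : cform) : cform :=
  match alpha with
  | CTrue => CFalse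
  | CFalse => CTrue
  | CAtom a => CAtom (lneg a)
  | CVar A => CVar (lneg A)
  | COr b g => CAnd (dual b) (dual g)
  | CAnd b g => COr (dual b) (dual g)
  end.

Fixpoint csize (alpha : cform) : nat :=
  match alpha with
  | CTrue | CFalse | CAtom _ | CVar _ => 1
  | COr b g | CAnd b g => csize b + csize g
  end.

Inductive context :=
| Hole
| OrL (xi : context) (beta : cform)
| OrR (beta : cform) (xi : context)
| AndL (xi : context) (beta : cform)
| AndR (beta : cform) (xi : context).

Fixpoint fill (xi : context) (alpha : cform) : cform :=
  match xi with
  | Hole => alpha
  | OrL x b => COr (fill x alpha) b
  | OrR b x => COr b (fill x alpha)
  | AndL x b => CAnd (fill x alpha) b
  | AndR b x => CAnd b (fill x alpha)
  end.

Inductive ceq : cform -> cform -> Prop :=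
| ceq_refl a : ceq a a
| ceq_sym a b : ceq a b -> ceq b a
| ceq_trans a b c : ceq a b -> ceq b c -> ceq a c
| ceq_ctx xi a b : ceq a b -> ceq (fill xi a) (fill xi b)
| ceq_orC a b : ceq (a \/ b) (b \/ a)
| ceq_andC a b : ceq (a /\ b) (b /\ a)
| ceq_orA a b c : ceq ((a \/ b) \/ c) (a \/ (b \/ c))
| ceq_andA a b c : ceq ((a /\ b) /\ c) (a /\ (b /\ c))
| ceq_or_false a : ceq (a \/ CFalse) a
| ceq_and_true a : ceq (a /\ CTrue) a
| ceq_true_true : ceq (CTrue \/ CTrue) CTrue
| ceq_false_false : ceq (CFalse /\ CFalse) CFalse.

(* A renaming and a substitution are given by their values on positive atoms
   and variables; the value on a negated one is the dual. *)
Fixpoint crename (rho : nat -> literal) (alpha : cform) : cform :=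
  match alpha with
  | CTrue => CTrue
  | CFalse => CFalse
  | CAtom (s, i) => CAtom (if s then rho i else lneg (rho i))
  | CVar A => CVar A
  | COr b g => COr (crename rho b) (crename rho g)
  | CAnd b g => CAnd (crename rho b) (crename rho g)
  end.

Fixpoint csubst (sigma : nat -> cform) (alpha : cform) : cform :=
  match alpha with
  | CTrue => CTrue
  | CFalse => CFalse
  | CAtom a => CAtom a
  | CVar (s, i) => if s then sigma i else dual (sigma i)
  | COr b g => COr (csubst sigma b) (csubst sigma g)
  | CAnd b g => CAnd (csubst sigma b) (csubst sigma g)
  end.

(* [S alpha beta] means that alpha / beta is a rule of the system S. *)
Definition system := cform -> cform -> Prop.

Definition rule_step (S : system) (gamma delta : cform) : Prop :=
  exists alpha beta rho sigma xi,
    [/\ S alpha beta,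
        gamma = fill xi (csubst sigma (crename rho alpha)) &
        delta = fill xi (csubst sigma (crename rho beta))].

Definition sub_step (gamma delta : cform) : Prop :=
  exists sigma, delta = csubst sigma gamma.

(* The chain alpha :: s alternates =-steps and [step]-steps; its first step,
   if any, is an =-step when [b] holds and a [step]-step otherwise. *)
Fixpoint alternating (step : cform -> cform -> Prop) (b : bool)
    (alpha : cform) (s : seq cform) : Prop :=
  match s with
  | [::] => True
  | beta :: s' =>
      (if b then ceq alpha beta else step alpha beta) /\
      alternating step (~~ b) beta s'
  end.

Definition derivation (step : cform -> cform -> Prop) (alpha beta : cform)
    (Phi : seq cform) : Prop :=
  exists s, [/\ Phi = alpha :: s, last alpha s = beta &
                exists b, alternating step b alpha s].

Definition derivation_size (Phi : seq cform) : nat := sumn (map csize Phi).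

Definition vA := CVar (true, 0).
Definition vB := CVar (true, 1).
Definition vC := CVar (true, 2).

Inductive SKSg : cform -> cform -> Prop :=
| SKSg_identity : SKSg CTrue (vA \/ dual vA)
| SKSg_cut : SKSg (vA /\ dual vA) CFalse
| SKSg_weakening : SKSg CFalse vA
| SKSg_coweakening : SKSg vA CTrue
| SKSg_contraction : SKSg (vA \/ vA) vA
| SKSg_cocontraction : SKSg vA (vA /\ vA)
| SKSg_switch : SKSg (vA /\ (vB \/ vC)) ((vA /\ vB) \/ vC).

Definition sSKSg_step (gamma delta : cform) : Prop :=
  rule_step SKSg gamma delta \/ sub_step gamma delta.

Definition sSKSg_proof (Phi : seq cform) (alpha : cform) : Prop :=
  derivation sSKSg_step CTrue alpha Phi.

(* Frege systems with substitution *)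

(* [inl i] corresponds to the i-th pair of dual atoms and [inr i] to the i-th
   pair of dual formula variables. *)
Definition fvar := (nat + nat)%type.

Inductive fform :=
| FTrue
| FFalse
| FVar (A : fvar)
| FOr (alpha beta : fform)
| FAnd (alpha beta : fform)
| FImp (alpha beta : fform)
| FNot (alpha : fform).

Declare Scope frege_scope.
Delimit Scope frege_scope with F.
Bind Scope frege_scope with fform.
Notation "alpha \/ beta" := (FOr alpha beta) : frege_scope.
Notation "alpha /\ beta" := (FAnd alpha beta) : frege_scope.
Notation "alpha --> beta" := (FImp alpha beta)
  (at level 90, right associativity) : frege_scope.
Notation "~ alpha" := (FNot alpha) : frege_scope.

Fixpoint fsize (alpha : fform) : nat :=
  match alpha with
  | FTrue | FFalse | FVar _ => 1
  | FOr b g | FAnd b g | FImp b g => fsize b + fsize g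
  | FNot b => fsize b
  end.

Fixpoint fsubst (sigma : fvar -> fform) (alpha : fform) : fform :=
  match alpha with
  | FTrue => FTrue
  | FFalse => FFalse
  | FVar A => sigma A
  | FOr b g => FOr (fsubst sigma b) (fsubst sigma g)
  | FAnd b g => FAnd (fsubst sigma b) (fsubst sigma g)
  | FImp b g => FImp (fsubst sigma b) (fsubst sigma g)
  | FNot b => FNot (fsubst sigma b)
  end.

Inductive frege_axiom : fform -> Prop :=
| F1 A B : frege_axiom (A --> (B --> (A /\ B)))
| F2 A B : frege_axiom ((A /\ B) --> A)
| F3 A B : frege_axiom ((A /\ B) --> B)
| F4 A B : frege_axiom (A --> (A \/ B))
| F5 A B : frege_axiom (B --> (A \/ B))
| F6 A : frege_axiom (~ ~ A --> A)
| F7 A : frege_axiom (A --> ~ ~ A)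
| F8 A B : frege_axiom (A --> (B --> A))
| F9 A B : frege_axiom (~ A --> (A --> B))
| F10 A B C :
    frege_axiom ((A --> (B --> C)) --> ((A --> B) --> (A --> C)))
| F11 A B C :
    frege_axiom ((A --> C) --> ((B --> C) --> ((A \/ B) --> C)))
| F12 A B C :
    frege_axiom ((A --> (B --> C)) --> (B --> (A --> C)))
| F13 A B : frege_axiom ((A --> B) --> (~ B --> ~ A))
| F14 A : frege_axiom (FFalse --> (A /\ ~ A))
| F15 A : frege_axiom ((A /\ ~ A) --> FFalse)
| F16 A : frege_axiom (FTrue --> (A \/ ~ A))
| F17 A : frege_axiom ((A \/ ~ A) --> FTrue).

Definition sFrege_line (Psi : seq fform) (i : nat) : Prop :=
  let line := nth FTrue Psi in
  [\/ frege_axiom (line i),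
      exists j k, [/\ j < i, k < i & line k = FImp (line j) (line i)] |
      exists j sigma, j < i /\ line i = fsubst sigma (line j)].

Definition sFrege_proof (Psi : seq fform) (alpha : fform) : Prop :=
  [/\ 0 < size Psi, last FTrue Psi = alpha &
      forall i, i < size Psi -> sFrege_line Psi i].

Definition sFrege_size (Psi : seq fform) : nat := sumn (map fsize Psi).

Fixpoint to_frege (alpha : cform) : fform :=
  match alpha with
  | CTrue => FTrue
  | CFalse => FFalse
  | CAtom (s, i) => if s then FVar (inl i) else FNot (FVar (inl i))
  | CVar (s, i) => if s then FVar (inr i) else FNot (FVar (inr i))
  | COr b g => FOr (to_frege b) (to_frege g)
  | CAnd b g => FAnd (to_frege b) (to_frege g)
  end.

(* Main.v *)
(** Every inference of an sSKSg proof is simulated by a short Frege proof of the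
    implication from its premiss to its conclusion, followed by modus ponens.
    The size of an =-chain hidden in a single =-step is unbounded, so its links
    cannot be simulated one by one.  But all the equations hold in every bounded
    lattice, so [ceq a b] yields [a <= b] in the free bounded lattice over the
    literals; by Whitman's theorem this order has a presentation without
    transitivity, in which a derivation of [a <= b] decomposes either [a] or [b]
    at each step and hence has O(|a||b|) inferences.  A substitution step leaves
    negated formulae where the calculus of structures has De Morgan duals; these
    are exchanged by proofs of linear length.  An inference in a proof of size n
    thus costs O(n^2) lines of size O(n), and there are at most n inferences. *)

Require Import Defs.
From mathcomp Require Import all_boot.
From mathcomp Require Import zify.

Set Implicit Arguments.
Unset Strict Implicit.
Unset Printing Implicit Defensive.

(** * Tree-like Frege proofs and their linearisation *)

Section TreeProofs.

Variable m : nat.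

(* [prf l x]: a tree-like proof of [x] with at most [l] lines, each of size at
   most [m]. *)
Inductive prf : nat -> fform -> Prop :=
| prf_weaken k l x : k <= l -> prf k x -> prf l x
| prf_axiom x : frege_axiom x -> fsize x <= m -> prf 1 x
| prf_mp k l x y : prf k (x --> y) -> prf l x -> prf (k + l).+1 y
| prf_subst l sigma x :
    fsize (fsubst sigma x) <= m -> prf l x -> prf l.+1 (fsubst sigma x).

Lemma sFrege_line_rcons Psi x :
  (forall i, i < size Psi -> sFrege_line Psi i) ->
  sFrege_line (rcons Psi x) (size Psi) ->
  forall i, i < size (rcons Psi x) -> sFrege_line (rcons Psi x) i.
Proof.
move=> PsiP xP i; rewrite size_rcons ltnS leq_eqVlt => /predU1P[-> //|lti].
have nthE j : j <= i -> nth FTrue (rcons Psi x) j = nth FTrue Psi j.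
  by move=> leji; rewrite nth_rcons (leq_ltn_trans leji lti).
case: (PsiP i lti) => [ax|[j [k [ltj ltk e]]]|[j [sigma [ltj e]]]].
- by constructor 1; rewrite nthE.
- by constructor 2; exists j, k; rewrite !nthE // ltnW.
- by constructor 3; exists j, sigma; rewrite !nthE // ltnW.
Qed.

Lemma sFrege_line_cat Psi1 Psi2 :
  (forall i, i < size Psi1 -> sFrege_line Psi1 i) ->
  (forall i, i < size Psi2 -> sFrege_line Psi2 i) ->
  forall i, i < size (Psi1 ++ Psi2) -> sFrege_line (Psi1 ++ Psi2) i.
Proof.
move=> P1 P2 i; rewrite size_cat => lti.
case: (ltnP i (size Psi1)) => [lti1|lei].
  have nthE j : j <= i -> nth FTrue (Psi1 ++ Psi2) j = nth FTrue Psi1 j.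
    by move=> leji; rewrite nth_cat (leq_ltn_trans leji lti1).
  case: (P1 i lti1) => [ax|[j [k [ltj ltk e]]]|[j [sigma [ltj e]]]].
  - by constructor 1; rewrite nthE.
  - by constructor 2; exists j, k; rewrite !nthE // ltnW.
  - by constructor 3; exists j, sigma; rewrite !nthE // ltnW.
have nthE j : nth FTrue (Psi1 ++ Psi2) (size Psi1 + j) = nth FTrue Psi2 j.
  by rewrite nth_cat ltnNge leq_addr /= addKn.
have iE : i = size Psi1 + (i - size Psi1) by rewrite subnKC.
have lti2 : i - size Psi1 < size Psi2 by rewrite ltn_subLR.
move: (i - _) iE lti2 => k -> ltk {lti lei i}.
case: (P2 k ltk) => [ax|[j [h [ltj lth e]]]|[j [sigma [ltj e]]]].
- by constructor 1; rewrite nthE.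
- by constructor 2; exists (size Psi1 + j), (size Psi1 + h);
    rewrite !nthE !ltn_add2l.
- by constructor 3; exists (size Psi1 + j), sigma; rewrite !nthE ltn_add2l.
Qed.

(** Listing the tree in postorder puts premisses before conclusions; repeated subproofs are simply
    kept, since [l] already charges for each of them. *)
Lemma prf_sFrege l x :
  prf l x ->
  exists Psi, [/\ sFrege_proof Psi x, size Psi <= l &
                  all (fun y => fsize y <= m) Psi].
Proof.
elim=> {l x} [k l x lekl _ [Psi [prfP szP leP]]|x ax lex|
  k l x y _ [P1 [[gt1 last1 line1] sz1 le1]] _ [P2 [[gt2 last2 line2] sz2 le2]]|
  l sigma x lesx _ [P1 [[gt1 last1 line1] sz1 le1]]].
- by exists Psi; split=> //; apply: leq_trans lekl.
- exists [:: x]; split=> //=; last by rewrite lex.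
  by split=> // -[] // _; constructor 1.
- have Pn P z : 0 < size P -> last FTrue P = z -> nth FTrue P (size P).-1 = z.
    by move=> _ <-; rewrite nth_last.
  exists (rcons (P1 ++ P2) y); split.
  + split; first by rewrite size_rcons.
      by rewrite last_rcons.
    apply: sFrege_line_rcons; first exact: sFrege_line_cat.
    (* The premisses are the last lines of the two blocks, the minor one shifted by the length of
       the first block. *)
    constructor 2; exists (size P1 + (size P2).-1), (size P1).-1.
    rewrite size_cat; split; [lia|lia|].
    rewrite !nth_rcons !size_cat ltnn eqxx.
    have -> : ((size P1).-1 < size P1 + size P2) by lia.
    have -> : (size P1 + (size P2).-1 < size P1 + size P2) by lia.
    rewrite !nth_cat prednK // leqnn ltnNge leq_addr /= addKn.
    by rewrite (Pn _ _ gt1 last1) (Pn _ _ gt2 last2).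
  + by rewrite size_rcons size_cat; lia.
  + rewrite all_rcons all_cat le1 le2 !andbT.
    (* The conclusion is part of [x --> y], itself a line of [P1]; this is why [prf_mp] carries no
       size condition. *)
    have : fsize (x --> y) <= m; last by move=> /=; lia.
    by rewrite -(Pn _ _ gt1 last1); apply: (all_nthP FTrue le1); lia.
- exists (rcons P1 (fsubst sigma x)); split.
  + split; first by rewrite size_rcons.
      by rewrite last_rcons.
    apply: sFrege_line_rcons => //.
    constructor 3; exists (size P1).-1, sigma; split; first by rewrite prednK.
    by rewrite !nth_rcons ltnn eqxx prednK // leqnn nth_last last1.
  + by rewrite size_rcons.
  + by rewrite all_rcons lesx.
Qed.

(** * Derived propositional rules with their costs *)

(** The combinator identity I = S K K; its largest line, the instance of F10, has size
    [9 * fsize x]. *)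
Lemma prf_imp_refl x : 9 * fsize x <= m -> prf 5 (x --> x).
Proof.
move=> le; apply: (@prf_mp 3 1 (x --> (x --> x))).
  apply: (@prf_mp 1 1 (x --> ((x --> x) --> x))).
    by apply: prf_axiom; [constructor | move=> /=; lia].
  by apply: prf_axiom; [constructor | move=> /=; lia].
by apply: prf_axiom; [constructor | move=> /=; lia].
Qed.

Lemma prf_const l x y :
  fsize x + 2 * fsize y <= m -> prf l y -> prf (l + 2) (x --> y).
Proof.
move=> le yP; apply: (@prf_weaken (1 + l).+1); first by lia.
by apply: prf_mp yP; apply: prf_axiom; [constructor | move=> /=; lia].
Qed.

(** F10 acts as modus ponens under the hypothesis [x]; no formula occurs in it more than three
    times, whence the factor 3. *)
Lemma prf_distr k l x y z :
  3 * (fsize x + fsize y + fsize z) <= m ->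
  prf k (x --> (y --> z)) -> prf l (x --> y) -> prf (k + l + 3) (x --> z).
Proof.
move=> le P1 P2; apply: (@prf_weaken ((1 + k).+1 + l).+1); first by lia.
apply: prf_mp P2; apply: prf_mp P1.
by apply: prf_axiom; [constructor | move=> /=; lia].
Qed.

Lemma prf_imp_trans k l x y z :
  3 * (fsize x + fsize y + fsize z) <= m ->
  prf k (x --> y) -> prf l (y --> z) -> prf (k + l + 5) (x --> z).
Proof.
move=> le P1 P2; apply: (@prf_weaken ((l + 2) + k + 3)); first by lia.
by apply: prf_distr P1 => //; apply: prf_const P2 => /=; lia.
Qed.

Lemma prf_contra l x y :
  2 * (fsize x + fsize y) <= m -> prf l (x --> y) -> prf (l + 2) (~ y --> ~ x).
Proof.
move=> le P; apply: (@prf_weaken (1 + l).+1); first by lia.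
by apply: prf_mp P; apply: prf_axiom; [constructor | move=> /=; lia].
Qed.

Lemma prf_contra_negl l x y :
  6 * (fsize x + fsize y) <= m -> prf l (~ x --> y) -> prf (l + 8) (~ y --> x).
Proof.
move=> le P; apply: (@prf_weaken ((l + 2) + 1 + 5)); first by lia.
apply: prf_imp_trans (prf_contra _ P) _ => /=; [lia|lia|].
by apply: prf_axiom; [constructor | move=> /=; lia].
Qed.

Lemma prf_contra_negr l x y :
  6 * (fsize x + fsize y) <= m -> prf l (x --> ~ y) -> prf (l + 8) (y --> ~ x).
Proof.
move=> le P; apply: (@prf_weaken (1 + (l + 2) + 5)); first by lia.
apply: prf_imp_trans (prf_contra _ P) => /=; [lia| |lia].
by apply: prf_axiom; [constructor | move=> /=; lia].
Qed.

Lemma prf_imp_and k l x y z :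
  6 * (fsize x + fsize y + fsize z) <= m ->
  prf k (x --> y) -> prf l (x --> z) -> prf (k + l + 9) (x --> (y /\ z)).
Proof.
move=> le P1 P2; apply: (@prf_weaken ((k + 1 + 5) + l + 3)); first by lia.
apply: prf_distr P2 => /=; first by lia.
apply: prf_imp_trans P1 _ => /=; first by lia.
by apply: prf_axiom; [constructor | move=> /=; lia].
Qed.

Lemma prf_or_imp k l x y z :
  3 * (fsize x + fsize y + fsize z) <= m ->
  prf k (x --> z) -> prf l (y --> z) -> prf (k + l + 3) ((x \/ y) --> z).
Proof.
move=> le P1 P2; apply: (@prf_weaken ((1 + k).+1 + l).+1); first by lia.
apply: prf_mp P2; apply: prf_mp P1.
by apply: prf_axiom; [constructor | move=> /=; lia].
Qed.

Lemma prf_imp_orl l x y z :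
  6 * (fsize x + fsize y + fsize z) <= m ->
  prf l (x --> y) -> prf (l + 6) (x --> (y \/ z)).
Proof.
move=> le P; apply: (@prf_weaken (l + 1 + 5)); first by lia.
apply: prf_imp_trans P _ => /=; first by lia.
by apply: prf_axiom; [constructor | move=> /=; lia].
Qed.

Lemma prf_imp_orr l x y z :
  6 * (fsize x + fsize y + fsize z) <= m ->
  prf l (x --> z) -> prf (l + 6) (x --> (y \/ z)).
Proof.
move=> le P; apply: (@prf_weaken (l + 1 + 5)); first by lia.
apply: prf_imp_trans P _ => /=; first by lia.
by apply: prf_axiom; [constructor | move=> /=; lia].
Qed.

Lemma prf_andl_imp l x y z :
  6 * (fsize x + fsize y + fsize z) <= m ->
  prf l (x --> z) -> prf (l + 6) ((x /\ y) --> z).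
Proof.
move=> le P; apply: (@prf_weaken (1 + l + 5)); first by lia.
apply: prf_imp_trans P => /=; first by lia.
by apply: prf_axiom; [constructor | move=> /=; lia].
Qed.

Lemma prf_andr_imp l x y z :
  6 * (fsize x + fsize y + fsize z) <= m ->
  prf l (y --> z) -> prf (l + 6) ((x /\ y) --> z).
Proof.
move=> le P; apply: (@prf_weaken (1 + l + 5)); first by lia.
apply: prf_imp_trans P => /=; first by lia.
by apply: prf_axiom; [constructor | move=> /=; lia].
Qed.

Lemma prf_or_mono k l x y x' y' :
  9 * (fsize x + fsize y + fsize x' + fsize y') <= m ->
  prf k (x --> x') -> prf l (y --> y') ->
  prf (k + l + 15) ((x \/ y) --> (x' \/ y')).
Proof.
move=> le P1 P2; apply: (@prf_weaken ((k + 6) + (l + 6) + 3)); first by lia.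
apply: prf_or_imp => /=; first by lia.
  by apply: prf_imp_orl P1; lia.
by apply: prf_imp_orr P2; lia.
Qed.

Lemma prf_and_mono k l x y x' y' :
  9 * (fsize x + fsize y + fsize x' + fsize y') <= m ->
  prf k (x --> x') -> prf l (y --> y') ->
  prf (k + l + 21) ((x /\ y) --> (x' /\ y')).
Proof.
move=> le P1 P2; apply: (@prf_weaken ((k + 6) + (l + 6) + 9)); first by lia.
apply: prf_imp_and => /=; first by lia.
  by apply: prf_andl_imp P1; lia.
by apply: prf_andr_imp P2; lia.
Qed.

Lemma fsize_gt0 x : 0 < fsize x.
Proof. by elim: x => //= *; lia. Qed.

(** F14 is instantiated at [x] itself, so that F2 projects the contradiction onto [x]. *)
Lemma prf_false_imp x : 12 * fsize x <= m -> prf 7 (FFalse --> x).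
Proof.
move=> le; have gt0 := fsize_gt0 x.
apply: (@prf_imp_trans 1 1 _ (x /\ ~ x)) => /=; first by lia.
  by apply: prf_axiom; [constructor | move=> /=; lia].
by apply: prf_axiom; [constructor | move=> /=; lia].
Qed.

Lemma prf_imp_true x : 12 * fsize x <= m -> prf 7 (x --> FTrue).
Proof.
move=> le; have gt0 := fsize_gt0 x.
apply: (@prf_imp_trans 1 1 _ (x \/ ~ x)) => /=; first by lia.
  by apply: prf_axiom; [constructor | move=> /=; lia].
by apply: prf_axiom; [constructor | move=> /=; lia].
Qed.

(** [FTrue] is detached from an implication whose premiss is an instance of F8 of size 3;
    [prf_imp_true] asks for 12 times that size, hence 36. *)
Lemma prf_true : 36 <= m -> prf 9 FTrue.
Proof.
move=> le; apply: (@prf_mp 7 1 (FTrue --> (FTrue --> FTrue))).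
  exact: prf_imp_true.
by apply: prf_axiom; [constructor | move=> /=; lia].
Qed.

(** In curried form, both [y] and [z] imply [x --> w]. Case analysis on the disjunction gives
    [x --> w] under the whole premiss, which also yields [x]. *)
Lemma prf_switch x y z :
  20 * (fsize x + fsize y + fsize z) <= m ->
  prf 33 ((x /\ (y \/ z)) --> ((x /\ y) \/ z)).
Proof.
move=> le; set w := ((x /\ y) \/ z)%F.
have P1 : prf 11 (x --> (y --> w)).
  apply: (@prf_imp_trans 1 5 _ (y --> (x /\ y))) => /=; first by lia.
    by apply: prf_axiom; [constructor | move=> /=; lia].
  apply: (@prf_mp 1 3 (y --> ((x /\ y) --> w))).
    by apply: prf_axiom; [constructor | move=> /=; lia].
  apply: (@prf_const 1) => /=; first by lia.
  by apply: prf_axiom; [constructor | move=> /=; lia].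
have P2 : prf 13 (y --> (x --> w)).
  apply: (@prf_mp 1 11 (x --> (y --> w))) => //.
  by apply: prf_axiom; [constructor | move=> /=; lia].
have P3 : prf 7 (z --> (x --> w)).
  apply: (@prf_imp_trans 1 1 _ w) => /=; first by lia.
    by apply: prf_axiom; [constructor | move=> /=; lia].
  by apply: prf_axiom; [constructor | move=> /=; lia].
apply: (@prf_distr 29 1 _ x) => /=; first by lia.
  apply: (@prf_imp_trans 1 23 _ (y \/ z)) => /=; first by lia.
    by apply: prf_axiom; [constructor | move=> /=; lia].
  by apply: prf_or_imp P2 P3 => /=; lia.
by apply: prf_axiom; [constructor | move=> /=; lia].
Qed.

End TreeProofs.

(** * Formula sizes and the free bounded lattice *)

Lemma csize_gt0 alpha : 0 < csize alpha.
Proof. by elim: alpha => //= *; lia. Qed.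

(** An exact equality, because negation adds nothing to [fsize]. *)
Lemma fsize_to_frege alpha : fsize (to_frege alpha) = csize alpha.
Proof. by elim: alpha => [||[[] i]|[[] i]|a /= -> b ->|a /= -> b ->]. Qed.

Lemma csize_dual alpha : csize (dual alpha) = csize alpha.
Proof. by elim: alpha => //= a -> b ->. Qed.


(* The order of the free bounded lattice over the literals, presented without
   transitivity as in Whitman's solution of its word problem. *)
Inductive lattice_le : cform -> cform -> Prop :=
| lle_refl a : lattice_le a a
| lle_false a : lattice_le CFalse a
| lle_true a : lattice_le a CTrue
| lle_or a b c : lattice_le a c -> lattice_le b c -> lattice_le (a \/ b) c
| lle_orl a b c : lattice_le a b -> lattice_le a (b \/ c)
| lle_orr a b c : lattice_le a c -> lattice_le a (b \/ c)
| lle_and a b c : lattice_le a b -> lattice_le a c -> lattice_le a (b /\ c)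
| lle_andl a b c : lattice_le a c -> lattice_le (a /\ b) c
| lle_andr a b c : lattice_le b c -> lattice_le (a /\ b) c.

Ltac csize_lia :=
  repeat match goal with a : cform |- _ =>
    lazymatch goal with _ : is_true (0 < csize a) |- _ => fail | _ => idtac end;
    have ? := csize_gt0 a end;
  simpl in *; lia.

(** Cut elimination by induction on the total size of the three formulae. If [b] is decomposed on
    both sides, the cut moves to a component of [b]; otherwise it is permuted above a rule acting on
    [a] or [c]. *)
Lemma lle_trans b a c : lattice_le a b -> lattice_le b c -> lattice_le a c.
Proof.
have [n] := ubnP (csize a + csize b + csize c).
elim: n a b c => // n IH a b c le ab bc.
have {}IH b' a' c' : lattice_le a' b' -> lattice_le b' c' ->
    csize a' + csize b' + csize c' < csize a + csize b + csize c ->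
    lattice_le a' c'.
  by move=> ab' bc' lt; apply: (IH _ b') => //; lia.
(* Undestructed copies of both hypotheses are kept for the permutation cases. *)
move: ab bc (ab) (bc) IH {le}.
case=> {a b} [a|a|a|a1 a2 b a1b a2b|a b1 b2 ab1|a b1 b2 ab2|a b1 b2 ab1 ab2|
  a1 a2 b a1b|a1 a2 b a2b] bc ab' bc' IH //.
- exact: lle_false.
- inversion bc; subst; try exact: lle_true.
  + by apply: lle_orl; apply: (IH CTrue) => //; csize_lia.
  + by apply: lle_orr; apply: (IH CTrue) => //; csize_lia.
  + by apply: lle_and; apply: (IH CTrue) => //; csize_lia.
- by apply: lle_or; apply: (IH b) => //; csize_lia.
- inversion bc; subst => //; first exact: lle_true.
  + by apply: (IH b1) => //; csize_lia.
  + by apply: lle_orl; apply: (IH (b1 \/ b2)%C) => //; csize_lia.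
  + by apply: lle_orr; apply: (IH (b1 \/ b2)%C) => //; csize_lia.
  + by apply: lle_and; apply: (IH (b1 \/ b2)%C) => //; csize_lia.
- inversion bc; subst => //; first exact: lle_true.
  + by apply: (IH b2) => //; csize_lia.
  + by apply: lle_orl; apply: (IH (b1 \/ b2)%C) => //; csize_lia.
  + by apply: lle_orr; apply: (IH (b1 \/ b2)%C) => //; csize_lia.
  + by apply: lle_and; apply: (IH (b1 \/ b2)%C) => //; csize_lia.
- inversion bc; subst => //; first exact: lle_true.
  + by apply: lle_orl; apply: (IH (b1 /\ b2)%C) => //; csize_lia.
  + by apply: lle_orr; apply: (IH (b1 /\ b2)%C) => //; csize_lia.
  + by apply: lle_and; apply: (IH (b1 /\ b2)%C) => //; csize_lia.
  + by apply: (IH b1) => //; csize_lia.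
  + by apply: (IH b2) => //; csize_lia.
- by apply: lle_andl; apply: (IH b) => //; csize_lia.
- by apply: lle_andr; apply: (IH b) => //; csize_lia.
Qed.

Lemma lle_fill xi a b : lattice_le a b -> lattice_le (fill xi a) (fill xi b).
Proof.
by move=> ab; elim: xi => //= [xi IH c|c xi IH|xi IH c|c xi IH];
  eauto using lattice_le.
Qed.

(** Both inequalities are carried through the induction because [ceq] is closed under symmetry. *)
Lemma ceq_lattice_le a b : ceq a b -> lattice_le a b /\ lattice_le b a.
Proof.
elim=> {a b} [a|a b _ []|a b c _ [ab ba] _ [bc cb]|xi a b _ [ab ba]|||||||
  |] *; try by split; eauto 8 using lattice_le.
- by split; apply: (@lle_trans b).
- by split; apply: lle_fill.
Qed.

(** * Frege simulation of single inferences *)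

Section Translation.

Variable m : nat.

(** Induction by De Morgan's laws. The term -100 occurs once in each of the two subproofs, which
    leaves 100 lines for the connective. *)
Lemma prf_dual alpha :
  40 * csize alpha <= m ->
  prf m (200 * csize alpha - 100) (~ to_frege alpha --> to_frege (dual alpha)) /\
  prf m (200 * csize alpha - 100) (to_frege (dual alpha) --> ~ to_frege alpha).
Proof.
elim: alpha => [||[[] i]|[[] i]|b IHb g IHg|b IHb g IHg] /= le.
- split; last by apply: prf_weaken (prf_false_imp _) => //=; lia.
  apply: (@prf_weaken _ (7 + 8)) => //; apply: prf_contra_negl => /=; first lia.
  by apply: prf_imp_true => /=; lia.
- split; first by apply: prf_weaken (prf_imp_true _) => //=; lia.
  apply: (@prf_weaken _ (7 + 8)) => //; apply: prf_contra_negr => /=; first lia.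
  by apply: prf_false_imp => /=; lia.
- by split; apply: prf_weaken (prf_imp_refl _) => //=; lia.
- by split; apply: (@prf_weaken _ 1) => //; apply: prf_axiom => //=;
    [constructor | lia | constructor | lia].
- by split; apply: prf_weaken (prf_imp_refl _) => //=; lia.
- by split; apply: (@prf_weaken _ 1) => //; apply: prf_axiom => //=;
    [constructor | lia | constructor | lia].
- have [|nb1 nb2] := IHb; first lia.
  have [|ng1 ng2] := IHg; first lia.
  have := csize_gt0 b; have := csize_gt0 g => gt0g gt0b.
  have szb := fsize_to_frege b; have szg := fsize_to_frege g.
  have szdb := fsize_to_frege (dual b); have szdg := fsize_to_frege (dual g).
  rewrite csize_dual in szdb; rewrite csize_dual in szdg.
  split.
    (* Contraposing the two injections into the disjunction gives both negated disjuncts. *)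
    apply: prf_weaken (prf_imp_and _
      (prf_imp_trans _ (prf_contra _ (prf_imp_orl _ (prf_imp_refl _))) nb1)
      (prf_imp_trans _ (prf_contra _ (prf_imp_orr _ (prf_imp_refl _))) ng1));
      by move=> /=; lia.
  apply: prf_weaken (prf_contra_negr _ (prf_or_imp _
    (prf_contra_negr _ (prf_andl_imp _ nb2))
    (prf_contra_negr _ (prf_andr_imp _ ng2)))); by move=> /=; lia.
- have [|nb1 nb2] := IHb; first lia.
  have [|ng1 ng2] := IHg; first lia.
  have := csize_gt0 b; have := csize_gt0 g => gt0g gt0b.
  have szb := fsize_to_frege b; have szg := fsize_to_frege g.
  have szdb := fsize_to_frege (dual b); have szdg := fsize_to_frege (dual g).
  rewrite csize_dual in szdb; rewrite csize_dual in szdg.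
  split.
    (* The classical law: if neither dual holds, then [b] and [g] both hold; this is contraposed. *)
    apply: prf_weaken (prf_contra_negl _ (prf_imp_and _
      (prf_imp_trans _ (prf_contra _ (prf_imp_orl _ (prf_imp_refl _)))
         (prf_contra_negl _ nb1))
      (prf_imp_trans _ (prf_contra _ (prf_imp_orr _ (prf_imp_refl _)))
         (prf_contra_negl _ ng1)))); by move=> /=; lia.
  apply: prf_weaken (prf_or_imp _
      (prf_imp_trans _ nb2 (prf_contra _ (prf_andl_imp _ (prf_imp_refl _))))
      (prf_imp_trans _ ng2 (prf_contra _ (prf_andr_imp _ (prf_imp_refl _)))));
    by move=> /=; lia.
Qed.

(** Decomposing either side splits the product of the sizes additively. With two subproofs the term
    -10 leaves 10 lines, and the costliest rule, [prf_imp_and], takes 9. *)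
Lemma prf_lattice_le a b :
  lattice_le a b -> 40 * (csize a + csize b) <= m ->
  prf m (20 * (csize a * csize b) - 10) (to_frege a --> to_frege b).
Proof.
have K x y : 0 < csize x * csize y by rewrite muln_gt0 !csize_gt0.
have F := fsize_to_frege.
elim=> {a b} [a|a|a|a b c _ IHa _ IHb|a b c _ IH|a b c _ IH|a b c _ IHa _ IHb|
  a b c _ IH|a b c _ IH] /=; rewrite ?mulnDl ?mulnDr => le.
- by apply: prf_weaken (prf_imp_refl _); have ? := K a a; rewrite ?F; lia.
- by apply: prf_weaken (prf_false_imp _); have ? := K CFalse a; rewrite ?F /=; lia.
- by apply: prf_weaken (prf_imp_true _); have ? := K a CTrue; rewrite ?F /=; lia.
- have ? := K a c; have ? := K b c.
  by apply: prf_weaken (prf_or_imp _ (IHa _) (IHb _)); rewrite ?F; lia.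
- have ? := K a b; have ? := K a c.
  by apply: prf_weaken (prf_imp_orl _ (IH _)); rewrite ?F; lia.
- have ? := K a b; have ? := K a c.
  by apply: prf_weaken (prf_imp_orr _ (IH _)); rewrite ?F; lia.
- have ? := K a b; have ? := K a c.
  by apply: prf_weaken (prf_imp_and _ (IHa _) (IHb _)); rewrite ?F; lia.
- have ? := K a c; have ? := K b c.
  by apply: prf_weaken (prf_andl_imp _ (IH _)); rewrite ?F; lia.
- have ? := K a c; have ? := K b c.
  by apply: prf_weaken (prf_andr_imp _ (IH _)); rewrite ?F; lia.
Qed.

(** Each connective above the hole costs at most 26 lines, 21 for monotonicity and 5 for the fixed
    side, and contributes at least 1 to the size. *)
Lemma prf_fill xi l a b :
  40 * (csize (fill xi a) + csize (fill xi b)) <= m ->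
  prf m l (to_frege a --> to_frege b) ->
  prf m (l + 30 * csize (fill xi a))
    (to_frege (fill xi a) --> to_frege (fill xi b)).
Proof.
move=> le ab; have F := fsize_to_frege.
elim: xi le => /= [|xi IH c|c xi IH|xi IH c|c xi IH] le.
- by apply: prf_weaken ab; lia.
- by apply: prf_weaken (prf_or_mono _ (IH _) (prf_imp_refl _)); rewrite ?F;
    csize_lia.
- by apply: prf_weaken (prf_or_mono _ (prf_imp_refl _) (IH _)); rewrite ?F;
    csize_lia.
- by apply: prf_weaken (prf_and_mono _ (IH _) (prf_imp_refl _)); rewrite ?F;
    csize_lia.
- by apply: prf_weaken (prf_and_mono _ (prf_imp_refl _) (IH _)); rewrite ?F;
    csize_lia.
Qed.

(** F16 and F15 give identity and cut with a negation in place of the dual; [prf_dual] exchanges the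
    two. *)
Lemma prf_SKSg a b rho sigma :
  let a' := csubst sigma (crename rho a) in
  let b' := csubst sigma (crename rho b) in
  SKSg a b -> 40 * (csize a' + csize b') <= m ->
  prf m (200 * (csize a' + csize b')) (to_frege a' --> to_frege b').
Proof.
have F := fsize_to_frege; have D := csize_dual.
move=> a' b' ac; rewrite {}/a' {}/b'.
(* The rules contain no atoms, so the renaming vanishes by computation. *)
case: ac => /=; move: (sigma 0) => A; rewrite ?D => le.
- have [|dA _] := @prf_dual A; first csize_lia.
  apply: prf_weaken (prf_imp_trans _ (prf_axiom (F16 _) _)
    (prf_or_mono _ (prf_imp_refl _) dA)) => /=; rewrite ?F ?D; csize_lia.
- have [|_ dA] := @prf_dual A; first csize_lia.
  apply: prf_weaken (prf_imp_trans _ (prf_and_mono _ (prf_imp_refl _) dA)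
    (prf_axiom (F15 _) _)) => /=; rewrite ?F ?D; csize_lia.
- by apply: prf_weaken (prf_false_imp _); rewrite ?F; csize_lia.
- by apply: prf_weaken (prf_imp_true _); rewrite ?F; csize_lia.
- by apply: prf_weaken (prf_or_imp _ (prf_imp_refl _) (prf_imp_refl _));
    rewrite ?F; csize_lia.
- by apply: prf_weaken (prf_imp_and _ (prf_imp_refl _) (prf_imp_refl _));
    rewrite ?F; csize_lia.
- by apply: prf_weaken (prf_switch _); rewrite ?F; csize_lia.
Qed.

(* Applied to a negated variable this gives a negation, where [csubst] gives a
   dual. *)
Definition frege_subst (sigma : nat -> cform) (v : fvar) : fform :=
  match v with inl _ => FVar v | inr i => to_frege (sigma i) end.

Lemma fsize_frege_subst sigma a :
  fsize (fsubst (frege_subst sigma) (to_frege a)) = csize (csubst sigma a).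
Proof.
by elim: a => [||[[] i]|[[] i]|a /= -> b ->|a /= -> b ->] //=;
  rewrite fsize_to_frege ?csize_dual.
Qed.

(** Only negated variables make a difference, and there [prf_dual] applies; monotonicity lifts the
    implication through the connectives, at most 21 lines each. *)
Lemma prf_subst_to_frege sigma a :
  40 * csize (csubst sigma a) <= m ->
  prf m (300 * csize (csubst sigma a) - 100)
    (fsubst (frege_subst sigma) (to_frege a) --> to_frege (csubst sigma a)).
Proof.
have F := fsize_to_frege; have E := fsize_frege_subst sigma.
elim: a => [||[[] i]|[[] i]|a IHa b IHb|a IHa b IHb] /= le;
  try by apply: prf_weaken (prf_imp_refl _); rewrite /= ?F; csize_lia.
- by apply: prf_weaken (prf_imp_refl _); rewrite /= ?F;
    have ? := csize_gt0 (sigma i); lia.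
- have ? := csize_gt0 (sigma i); move: le; rewrite csize_dual => le.
  by have [|dA _] := @prf_dual (sigma i); [|apply: prf_weaken dA]; lia.
- have ? := csize_gt0 (csubst sigma a); have ? := csize_gt0 (csubst sigma b).
  by apply: prf_weaken (prf_or_mono _ (IHa _) (IHb _)); rewrite ?F ?E; lia.
- have ? := csize_gt0 (csubst sigma a); have ? := csize_gt0 (csubst sigma b).
  by apply: prf_weaken (prf_and_mono _ (IHa _) (IHb _)); rewrite ?F ?E; lia.
Qed.

Lemma prf_step (b : bool) l n x y :
  csize x + csize y <= n -> 40 * n <= m ->
  (if b then ceq x y else sSKSg_step x y) ->
  prf m l (to_frege x) -> prf m (l + 300 * n ^ 2) (to_frege y).
Proof.
move=> len lem xy xP; have F := fsize_to_frege.
have ? := csize_gt0 x; have ? := csize_gt0 y.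
have n2 : n <= n ^ 2 by nia.
case: b xy => [/ceq_lattice_le[xy _]|[|[sigma yE]]].
- have prod : csize x * csize y <= n ^ 2 by nia.
  by apply: prf_weaken (prf_mp (prf_lattice_le xy _) xP); lia.
- case=> a [c [rho [sigma [xi [ac xE yE]]]]].
  (* The bound [n] on the whole formulae thus covers the rule instance inside the context. *)
  have lea e : csize e <= csize (fill xi e).
    by elim: xi {xE yE} => //= *; csize_lia.
  have ? := lea (csubst sigma (crename rho a)).
  have ? := lea (csubst sigma (crename rho c)).
  subst x y.
  have /= P := @prf_SKSg _ _ rho sigma ac.
  by apply: prf_weaken (prf_mp (prf_fill _ (P _)) xP); lia.
- rewrite yE in xP len *.
  apply: prf_weaken (prf_mp (prf_subst_to_frege _)
    (@prf_subst _ _ (frege_subst sigma) _ _ xP)); rewrite ?fsize_frege_subst; lia.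
Qed.

(** * Whole proofs and the final bounds *)

Lemma prf_alternating s b l n x :
  csize x + sumn (map csize s) <= n -> 40 * n <= m ->
  alternating sSKSg_step b x s ->
  prf m l (to_frege x) ->
  prf m (l + 300 * n ^ 2 * size s) (to_frege (last x s)).
Proof.
elim: s b l x => [|y s IH] b l x /= le lem.
  by move=> _; apply: prf_weaken; lia.
case=> xy ys xP; rewrite mulnS addnA.
by apply: IH ys _ => //; [lia | apply: prf_step xy xP => //; lia].
Qed.

End Translation.

Theorem theorem5p13 :
  exists c : nat,
    forall (Phi : seq cform) (alpha : cform),
      sSKSg_proof Phi alpha ->
      exists Psi : seq fform,
        [/\ sFrege_proof Psi (to_frege alpha),
            size Psi <= c * derivation_size Phi ^ 4 &
            sFrege_size Psi <= c * derivation_size Phi ^ 5].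
Proof.
(* There are at most 9 + 300 n^3 lines, bounded by 400 n^4, and each has size at most 40 n. *)
exists (400 * 40) => Phi alpha [s [-> <- [b altP]]].
set n := derivation_size _.
have n_gt0 : 0 < n by rewrite /n /derivation_size /=.
have les : size s <= n.
  rewrite /n /derivation_size /=.
  by elim: s {altP n n_gt0} => //= a s IH; have := csize_gt0 a; lia.
(* The simulation starts from a proof of the premiss; positivity of [n] provides the size 36 needed
   here. *)
have trueP : prf (40 * n) 9 FTrue by apply: prf_true; lia.
have := @prf_alternating (40 * n) s b 9 n CTrue (leqnn _) (leqnn _) altP trueP.
case/prf_sFrege=> Psi [PsiP szPsi lePsi]; exists Psi.
have le1 : size Psi <= 400 * n ^ 4.
  apply: leq_trans szPsi _.
  have -> : n ^ 4 = n ^ 2 * n * n by rewrite -!expnSr.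
  have : n ^ 2 * size s <= n ^ 2 * n * n.
    by rewrite -mulnA leq_mul2l (leq_trans les) ?orbT // leq_pmulr.
  have : 0 < n ^ 2 * n * n by rewrite !muln_gt0 n_gt0.
  by rewrite -mulnA; lia.
split=> //; first by apply: leq_trans le1 _; rewrite leq_mul2r orbT.
apply: (@leq_trans (size Psi * (40 * n))).
  rewrite /sFrege_size; elim: Psi lePsi {PsiP szPsi le1} => //= x Psi IH.
  by case/andP=> lex /IH; lia.
apply: leq_trans (leq_mul le1 (leqnn _)) _.
by rewrite (expnSr n 4) mulnACA.
Qed.
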